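(* Let $G$ be a simple graph, let $k,u,v,d,c,k_1,k_2\in\mathbb{Z}$ and $n\in\mathbb{Z}^+$. In each of the following statements, assume the right-hand side exists. Then: (i) if $[u]$ is a unit in $\mathbb{Z}_n$, then $\chi_{n,uk}(G)=\chi_{n,k}(G)$; (ii) $\chi_{n,vk}(G)\le\chi_{n,k}(G)$; (iii) if $d$ is a common divisor of $k$ and $n$ (with $d>0$), then $\chi_{n,k}(G)\le\chi_{n/d,k/d}(G)$; (iv) if $d$ divides $n$ (with $d>0$), then $\chi_{n/d,k}(G)\le\chi_{n,k}(G)$; (v) if $G$ admits a constant closed coloring with remainder $c\bmod n$, then $\chi_{n,k-c}(G)=\chi_{n,k}(G)$; (vi) $\chi_{n,k_1+k_2}(G)\le\chi_{n,k_1}(G)\,\chi_{n,k_2}(G)$.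
   Context: Graphs are simple, possibly infinite, $G=(V,E)$. A labeling is a map $\ell:V\to\mathbb{Z}$; its order is the size of its image; it is proper if adjacent vertices get different labels. $N[v]$ is the closed neighborhood of $v$. A closed coloring with remainder $k\bmod n$ is a labeling with $\sum_{w\in N[v]}\ell(w)\equiv k\pmod n$ for all $v\in V$. If no proper closed coloring with remainder $k\bmod n$ exists, $\chi_{n,k}(G)$ does not exist; otherwise $\chi_{n,k}(G)$ is the minimum order of a proper closed coloring with remainder $k\bmod n$ (taken to be $\infty$ if all such colorings have infinite order). *)

(* Defs.v *)
From mathcomp Require Import all_boot all_order all_algebra finmap.
From mathcomp Require Import all_classical constructive_ereal.

Set Implicit Arguments.
Unset Strict Implicit.
Unset Printing Implicit Defensive.

Import Order.TTheory GRing.Theory Num.Theory.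

Local Open Scope classical_set_scope.
Local Open Scope ring_scope.

(* Vertices form a choiceType only because finitely supported sums ask for it;
   classically every type has such a structure. *)
Record simple_graph := SimpleGraph {
  vertex :> choiceType;
  adj : vertex -> vertex -> Prop;
  adj_sym : forall v w, adj v w -> adj w v;
  adj_irrefl : forall v, ~ adj v v
}.

Definition labeling (G : simple_graph) := G -> int.

Definition closed_nbhd (G : simple_graph) (v : G) : set G :=
  [set w | w = v \/ adj v w].

Definition proper_labeling (G : simple_graph) (l : labeling G) : Prop :=
  forall v w : G, adj v w -> l v <> l w.

(* No local finiteness is imposed on G. The sum over N[v] is required to make
   sense, i.e. to have finitely many nonzero terms; this holds automatically
   when N[v] is finite. The condition is needed because \sum_(w \in A) is 0 by
   convention when there are infinitely many nonzero terms. *)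
Definition closed_coloring (G : simple_graph) (n k : int) (l : labeling G)
    : Prop :=
  forall v : G,
    finite_set (closed_nbhd v `&` [set w | l w != 0]) /\
    (\sum_(w \in closed_nbhd v) l w = k %[mod n])%Z.

Definition proper_closed_coloring (G : simple_graph) (n k : int)
    (l : labeling G) : Prop :=
  closed_coloring n k l /\ proper_labeling l.

(* Cardinal of the image, valued in N u {oo} seen inside \bar int. *)
Definition labeling_order (G : simple_graph) (l : labeling G) : \bar int :=
  if `[< finite_set (range l) >] then (#|` fset_set (range l)|%:Z)%:E else +oo%E.

Definition orders (G : simple_graph) (n k : int) : set (\bar int) :=
  [set labeling_order l | l in [set l : labeling G | proper_closed_coloring n k l]].

Definition chi_exists (n k : int) (G : simple_graph) : Prop :=
  exists l : labeling G, proper_closed_coloring n k l.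

(* The least element of [orders G n k]. The default +oo is only reached when
   [chi_exists n k G] fails, in which case the value is meaningless and
   statements about it must be guarded by [chi_exists]. *)
Definition chi (n k : int) (G : simple_graph) : \bar int :=
  xget +oo%E [set x | orders G n k x /\ lbound (orders G n k) x].

(* [u] is a unit of Z/nZ. MathComp's 'Z_n is not usable here, since 'Z_1 is
   Z/2Z rather than the zero ring. *)
Definition unit_mod (n u : int) : Prop :=
  exists w : int, (u * w = 1 %[mod n])%Z.

(* Main.v *)
(* Multiplying the labels by a nonzero integer a sends remainder k mod n to
   remainder a k mod any divisor of a n, without increasing the order; this
   gives (i)-(iv). Translating by a constant coloring gives (v). For (vi), two
   labelings are merged into f(l1, l2), where f is injective, f(a, b) = a + b
   mod n, and f(0, 0) = 0 so that neighborhood sums stay finitely supported. *)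
Require Import Defs.
From mathcomp Require Import all_boot all_order all_algebra.
From mathcomp Require Import finmap.
From mathcomp Require Import all_classical constructive_ereal.

Import Order.TTheory GRing.Theory Num.Theory.
Local Open Scope ring_scope.

Section closed_colorings.
Set Implicit Arguments.
Unset Strict Implicit.
Local Open Scope classical_set_scope.
Context {G : simple_graph}.
Implicit Types (l : labeling G) (n k a b : int).

Lemma labeling_orderP l :
  (exists m : nat, labeling_order l = m%:Z%:E) \/ labeling_order l = +oo%E.
Proof. by rewrite /labeling_order; case: ifP => _; [left; eexists|right]. Qed.

Lemma labeling_order_ge0 l : (0 <= labeling_order l)%E.
Proof. by case: (labeling_orderP l) => [[m]|] ->. Qed.

Lemma labeling_order_comp (f : int -> int) l :
  (labeling_order (f \o l) <= labeling_order l)%E.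
Proof.
rewrite /labeling_order; case: (asboolP (finite_set (range l))) => fl;
  last exact: leey.
have e : range (f \o l) = f @` range l by rewrite image_comp.
have fe : finite_set (range (f \o l)) by rewrite e; exact: finite_image.
rewrite asboolT// lee_fin lez_nat e fset_set_image//.
exact: leq_imfset_card.
Qed.

Lemma labeling_order_gt0 l (v : G) : (0 < labeling_order l)%E.
Proof.
rewrite /labeling_order; case: asboolP => fl //.
rewrite lte_fin ltz_nat cardfs_gt0; apply/fset0Pn; exists (l v).
by rewrite in_fset_set// inE; exists v.
Qed.

(** Every value of the merged labeling is [f] of a pair in the product of the two images, which is
    counted by the list of all such pairs. *)
Lemma labeling_order_comp2 (f : int -> int -> int) l1 l2 :
  (labeling_order (fun v => f (l1 v) (l2 v))
     <= labeling_order l1 * labeling_order l2)%E.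
Proof.
(* A vertex makes both orders positive, so that an infinite factor yields the product [+oo]; the
   convention [0 * +oo = 0] would spoil the bound. *)
have [[v _]|nG] := pselect (exists v : G, True); last first.
  have G0 : [set: G] = set0.
    by apply/seteqP; split=> v // _; apply: nG; exists v.
  rewrite [leLHS](_ : _ = 0%E); last first.
    rewrite /labeling_order G0 image_set0 asboolT//.
    by rewrite fset_set0 cardfs0.
  by apply: mule_ge0; exact: labeling_order_ge0.
have [fl1|nf1] := pselect (finite_set (range l1)); last first.
  by rewrite {2}/labeling_order asboolF// gt0_mulye ?leey// labeling_order_gt0.
have [fl2|nf2] := pselect (finite_set (range l2)); last first.
  by rewrite {3}/labeling_order asboolF// gt0_muley ?leey// labeling_order_gt0.
have fr := finite_image11 f fl1 fl2.
rewrite /labeling_order !asboolT// -EFinM lee_fin -PoszM lez_nat.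
rewrite -(size_allpairs f (fset_set (range l1)) (fset_set (range l2))).
apply: uniq_leq_size => [|x]; first exact: fset_uniq.
rewrite in_fset_set// inE => -[w _ <-].
by apply: allpairs_f; rewrite in_fset_set// inE; exists w.
Qed.

(** Multiplying by [a] turns a congruence mod [n] into one mod [a * n], which then descends to the
    divisor [n']. *)
Lemma closed_coloring_scale a n k n' k' l :
  (n' %| a * n)%Z -> (a * k = k' %[mod n'])%Z ->
  closed_coloring n k l -> closed_coloring n' k' (fun v => a * l v).
Proof.
move=> dvd_an akk' cl v; have [fin_l /eqP sum_l] := cl v.
split.
  apply: sub_finite_set fin_l => w [vw /= alw]; split=> //=.
  by apply: contraNneq alw => ->; rewrite mulr0.
rewrite -mulr_fsumr -akk'; apply/eqP; rewrite eqz_mod_dvd -mulrBr.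
by apply: dvdz_trans dvd_an _; rewrite dvdz_mul// -eqz_mod_dvd.
Qed.

(** Inside the neighborhood, both labelings vanish off the union [S] of their finite supports, and
    so does the merged one by [f 0 0 = 0]. All three sums thus become finite sums over [S]. *)
Lemma closed_coloring_comp2 (f : int -> int -> int) n k1 k2 l1 l2 :
  f 0 0 = 0 -> (forall a b, (f a b = a + b %[mod n])%Z) ->
  closed_coloring n k1 l1 -> closed_coloring n k2 l2 ->
  closed_coloring n (k1 + k2) (fun v => f (l1 v) (l2 v)).
Proof.
move=> f00 fD cl1 cl2 v; have [fin1 sum1] := cl1 v; have [fin2 sum2] := cl2 v.
set A := closed_nbhd v in fin1 sum1 fin2 sum2 *.
pose S := (A `&` [set w | l1 w != 0]) `|` (A `&` [set w | l2 w != 0]).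
have finS : finite_set S by rewrite finite_setU.
have l0 w : A w -> ~ S w -> l1 w = 0 /\ l2 w = 0.
  move=> Aw nSw; split; apply/eqP/negP => /negP lw; apply: nSw.
    by left.
  by right.
have SA : S `<=` A by move=> w [[]|[]].
have sumS (g : G -> int) : (forall w, A w -> ~ S w -> g w = 0) ->
    \sum_(w \in A) g w = \sum_(w <- fset_set S) g w.
  move=> g0; rewrite -fsbig_finite//; apply/esym/fsbig_widen => // w [Aw nSw].
  exact: g0.
split.
  apply: sub_finite_set finS => w [Aw /= fw]; apply: contrapT => nSw.
  by have [e1 e2] := l0 w Aw nSw; rewrite e1 e2 f00 eqxx in fw.
rewrite sumS; last by move=> w Aw nSw; have [-> ->] := l0 w Aw nSw.
rewrite -modzDm -sum1 -sum2 modzDm !sumS;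
  do ?by move=> w Aw nSw; have [] := l0 w Aw nSw.
(* Termwise congruence mod [n] is preserved by finite sums. *)
rewrite -big_split/=; elim/big_ind2: _ => // x1 x2 y1 y2 e1 e2.
by rewrite -modzDm e1 e2 modzDm.
Qed.

(** Orders are natural numbers or [+oo]: either some order is finite and well-ordering gives a least
    one, or all are [+oo]. Hence [xget] returns a genuine minimum. *)
Lemma chiP n k : chi_exists n k G ->
  orders G n k (chi n k G) /\ lbound (orders G n k) (chi n k G).
Proof.
move=> [l0 pl0].
apply: (@xgetPex _ +oo%E [set x | orders G n k x /\ lbound (orders G n k) x]).
have [exP|nexP] := pselect (exists m : nat, `[< orders G n k m%:Z%:E >]);
  last first.
  have noFin l : proper_closed_coloring n k l -> labeling_order l = +oo%E.
    move=> pl; case: (labeling_orderP l) => // -[m lm]; exfalso; apply: nexP.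
    by exists m; apply/asboolP; exists l.
  exists +oo%E; split; first by exists l0 => //; exact: noFin.
  by move=> _ [l pl <-]; rewrite noFin.
case: (ex_minnP exP) => m /asboolP Pm min_m; exists m%:Z%:E; split=> //.
move=> _ [l pl <-]; case: (labeling_orderP l) => [[j lj]|->]; last exact: leey.
by rewrite lj lee_fin lez_nat; apply: min_m; apply/asboolP; exists l.
Qed.

Lemma chi_le_order n k l :
  proper_closed_coloring n k l -> (chi n k G <= labeling_order l)%E.
Proof.
move=> pl; have /chiP[_ lb] : chi_exists n k G by exists l.
by apply: lb; exists l.
Qed.

(** Scale a labeling that attains the minimum; as [a] is nonzero, distinct labels stay distinct and
    properness survives. *)
Lemma chi_le_scale a n k n' k' : a != 0 ->
  (n' %| a * n)%Z -> (a * k = k' %[mod n'])%Z ->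
  chi_exists n k G -> chi_exists n' k' G /\ (chi n' k' G <= chi n k G)%E.
Proof.
move=> a0 dvd_an akk' /chiP[[l [cl pl] <-] _].
have pcl : proper_closed_coloring n' k' (fun v => a * l v).
  split; first exact: closed_coloring_scale cl.
  by move=> v w vw /(mulfI a0); exact: pl.
split; first by exists (fun v => a * l v).
apply: (le_trans (chi_le_order pcl)); exact: labeling_order_comp ( *%R a) l.
Qed.

(* If a = 0, multiplication by a would destroy properness; use n instead. *)
Lemma chi_le_mul a n k k' : n != 0 -> (a * k = k' %[mod n])%Z ->
  chi_exists n k G -> chi_exists n k' G /\ (chi n k' G <= chi n k G)%E.
Proof.
move=> n0 akk'; have [a0|a0] := eqVneq a 0; last first.
  by apply: (@chi_le_scale a) => //; exact: dvdz_mull.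
apply: (@chi_le_scale n) => //; first exact: dvdz_mull.
by rewrite -akk' a0 mul0r mod0z modzMr.
Qed.

Lemma chi_le_shift a n k c : closed_coloring n c (fun _ : G => a) ->
  chi_exists n k G ->
  chi_exists n (k + c) G /\ (chi n (k + c) G <= chi n k G)%E.
Proof.
move=> ca /chiP[[l [cl pl] <-] _].
have pcl : proper_closed_coloring n (k + c) (fun v => l v + a).
  (* Translation is the merge by plain addition with a constant labeling. *)
  split; first exact: (@closed_coloring_comp2 +%R _ _ _ l (fun=> a)).
  by move=> v w vw /addIr; exact: pl.
split; first by exists (fun v => l v + a).
apply: (le_trans (chi_le_order pcl)); exact: labeling_order_comp (+%R^~ a) l.
Qed.

(* Labelings of infinite order admit in general no M for which
   a + (1 + M n) b is injective on the pairs of labels. Taking instead an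
   arbitrary injection Z x Z -> Z as the quotient by n works on all of Z x Z. *)
Lemma injective_addz_mod n : n != 0 ->
  exists f : int -> int -> int, [/\ f 0 0 = 0,
    forall a b, (f a b = a + b %[mod n])%Z &
    forall a b a' b', f a b = f a' b' -> (a, b) = (a', b')].
Proof.
(* Countability of pairs of integers supplies the injection; subtracting the code of [(0, 0)]
   normalizes [p 0 0] to 0, whence [f 0 0 = 0]. *)
move=> n0; pose p (a b : int) : int :=
  (choice.pickle (a, b))%:Z - (choice.pickle (0 : int, 0 : int))%:Z.
exists (fun a b => ((a + b)%R %% n)%Z + p a b * n); split.
- by rewrite addr0 mod0z add0r /p subrr mul0r.
- by move=> a b; rewrite addrC modzMDl modz_mod.
(* Equal values have equal residues; cancelling these and the factor [n] leaves equal codes. *)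
move=> a b a' b' e; have er : ((a + b)%R %% n = (a' + b')%R %% n)%Z.
  by have := congr1 (modz^~ n) e;
    rewrite /= ![_ + p _ _ * n]addrC !modzMDl !modz_mod.
move: e; rewrite er => /addrI/(mulIf n0)/addIr[].
exact: (pcan_inj (@choice.pickleK _)).
Qed.

Lemma chi_le_add n k1 k2 : n != 0 -> chi_exists n k1 G -> chi_exists n k2 G ->
  chi_exists n (k1 + k2) G /\
  (chi n (k1 + k2) G <= chi n k1 G * chi n k2 G)%E.
Proof.
move=> n0 /chiP[[l1 [cl1 pl1] <-] _] /chiP[[l2 [cl2 _] <-] _].
have [f [f00 fD f_inj]] := injective_addz_mod n0.
have pcl : proper_closed_coloring n (k1 + k2) (fun v => f (l1 v) (l2 v)).
  split; first exact: closed_coloring_comp2.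
  (* Equal merged labels on adjacent vertices would force equal [l1] labels. *)
  by move=> v w vw /f_inj[e _]; exact: pl1 e.
split; first by exists (fun v => f (l1 v) (l2 v)).
apply: (le_trans (chi_le_order pcl)); exact: labeling_order_comp2 f l1 l2.
Qed.

End closed_colorings.

Theorem theorem3p3 (G : simple_graph) (k u v d c k1 k2 n : int) (hn : 0 < n) :
  (unit_mod n u -> chi_exists n k G ->
     chi_exists n (u * k) G /\ chi n (u * k) G = chi n k G) /\
  (chi_exists n k G ->
     chi_exists n (v * k) G /\ (chi n (v * k) G <= chi n k G)%E) /\
  (0 < d -> (d %| k)%Z -> (d %| n)%Z ->
     chi_exists (n %/ d)%Z (k %/ d)%Z G ->
     chi_exists n k G /\ (chi n k G <= chi (n %/ d)%Z (k %/ d)%Z G)%E) /\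
  (0 < d -> (d %| n)%Z -> chi_exists n k G ->
     chi_exists (n %/ d)%Z k G /\ (chi (n %/ d)%Z k G <= chi n k G)%E) /\
  ((exists a : int, @closed_coloring G n c (fun _ => a)) ->
     chi_exists n k G ->
     chi_exists n (k - c) G /\ chi n (k - c) G = chi n k G) /\
  (chi_exists n k1 G -> chi_exists n k2 G ->
     chi_exists n (k1 + k2) G /\
     (chi n (k1 + k2) G <= chi n k1 G * chi n k2 G)%E).
Proof.
have n0 : n != 0 by rewrite gt_eqF.
split; [|split; [|split; [|split; [|split]]]].
- move=> [w uw] exk.
  have [exuk le1] := chi_le_mul n0 (erefl (u * k %% n)%Z) exk.
  split=> //; apply/le_anti; rewrite le1/=.
  (* The reverse inequality multiplies back by the inverse [w] of [u] mod [n]. *)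
  apply: (proj2 (@chi_le_mul _ w _ _ _ n0 _ exuk)).
  by rewrite mulrA (mulrC w) -modzMml uw modzMml mul1r.
- exact: chi_le_mul.
- move=> d0 dk dn; apply: (@chi_le_scale _ d); first by rewrite gt_eqF.
    by rewrite mulrC divzK.
  by rewrite mulrC divzK.
(* With factor 1 the labeling is kept and only the modulus shrinks to a divisor. *)
- move=> d0 dn; apply: (@chi_le_scale _ 1) => //; last by rewrite mul1r.
  by rewrite mul1r -[X in (_ %| X)%Z](divzK dn) dvdz_mulr.
- move=> [a ca] exk.
  (* The opposite constant has remainder [- c]: shifting by it gives one inequality, and shifting
     back by [a] the other. *)
  have cNa : closed_coloring n (- c) (fun _ : G => -1 * a).
    by apply: closed_coloring_scale ca; [exact: dvdz_mull|rewrite mulN1r].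
  have [exkc le1] := chi_le_shift cNa exk.
  split=> //; apply/le_anti; rewrite le1/=.
  by have [_] := chi_le_shift ca exkc; rewrite subrK.
exact: chi_le_add.
Qed.
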